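(* Let $\kappa\ge 1$ and let $\mathcal F=\{f_1,\dots,f_M\}$ be a finite set of prediction rules with $M\ge 3$. Denote by $\mathcal C$ the convex hull of $\mathcal F$. Assume that $\pi$ satisfies the margin assumption MA($\kappa$). The aggregate $\tilde f_n=\sum_{j=1}^M w_j^{(n)}f_j$ with the exponential weights $$w_j^{(n)}=\frac{\exp\left(\sum_{i=1}^nY_if_j(X_i)\right)}{\sum_{k=1}^M\exp\left(\sum_{i=1}^nY_if_k(X_i)\right)}=\frac{\exp\left(-nA_n(f_j)\right)}{\sum_{k=1}^M\exp\left(-nA_n(f_k)\right)},\quad j=1,\dots,M,$$ satisfies for any integers $n,M$ and any $a>0$ the inequality $$\mathbb E\left[A(\tilde f_n)-A^*\right]\le(1+a)\min_{f\in\mathcal C}(A(f)-A^* )+C\left(\frac{\log M}{n}\right)^{\frac{\kappa}{2\kappa-1}},$$ where $C>0$ is a constant depending only on $a$.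
   Context: $(\mathcal X,\mathcal A)$ is a measurable space, $(X,Y)$ is a random variable with values in $\mathcal X\times\{-1,1\}$ and distribution $\pi$, and $D_n=(X_i,Y_i)_{i=1,\dots,n}$ are $n$ i.i.d. observations of $(X,Y)$. A prediction rule is a measurable function $f:\mathcal X\to\{-1,1\}$; its misclassification error is $R(f)=\mathbb P(Y\ne f(X))$. Let $\eta(x)=\mathbb P(Y=1\mid X=x)$; the Bayes rule is $f^*(x)=\mathrm{sign}(2\eta(x)-1)$, and $R^*=R(f^* )=\min_fR(f)$. The hinge risk of a measurable $f:\mathcal X\to\mathbb R$ is $A(f)=\mathbb E[\max(0,1-Yf(X))]$, its empirical analog is $A_n(f)=\frac1n\sum_{i=1}^n\max(0,1-Y_if(X_i))$, and $A^*=\inf_fA(f)$, the infimum being over all measurable real valued functions. For the data-dependent function $\tilde f_n$, $A(\tilde f_n)$ is the hinge risk conditionally on $D_n$, and the outer expectation is over $D_n$. Margin assumption MA($\kappa$), $1\le\kappa<+\infty$: there exists $c_0>0$ such that $\mathbb E|f(X)-f^*(X)|\le c_0(R(f)-R^* )^{1/\kappa}$ for all measurable $f:\mathcal X\to\{-1,1\}$.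
   Formalization: The constant C depends on a and on the constant c_0 of the margin assumption MA(κ), not on a alone; with C depending only on a the claim fails (κ=1, η=1/2+n^{-1/2}, rules 1, −1 and one equal to 1 a.s.). *)

(* Defs.v *)
From HB Require Import structures.
From mathcomp Require Import all_boot all_order all_algebra.
From mathcomp Require Import all_classical all_reals all_analysis.

Set Implicit Arguments.
Unset Strict Implicit.
Unset Printing Implicit Defensive.

Import Order.TTheory GRing.Theory Num.Theory.

Local Open Scope classical_set_scope.
Local Open Scope ring_scope.

Section classification.
Context {d d' : measure_display} {Omega : measurableType d}
  {T : measurableType d'} {R : realType} (P : probability Omega R).

Definition prediction_rule (f : T -> R) : Prop :=
  measurable_fun setT f /\ forall x, f x = -1 \/ f x = 1.

Section risks.
Variables (X : Omega -> T) (Y : Omega -> R).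

Definition misclassification_error (f : T -> R) : R :=
  fine (P [set w | Y w != f (X w)]).

(* [eta] is a version of the conditional probability of Y = 1 given X. *)
Definition regression_function (eta : T -> R) : Prop :=
  [/\ measurable_fun setT eta,
      P.-integrable setT (fun w => (eta (X w))%:E) &
      forall B : set T, measurable B ->
        P ((Y @^-1` [set 1]) `&` (X @^-1` B)) =
        (\int[P]_(w in X @^-1` B) (eta (X w))%:E)%E].

(* The sign takes its values in {-1, 1}, with sign 0 = 1 (the margin assumption
   below forces eta(X) <> 1/2 almost surely). *)
Definition bayes_rule (eta : T -> R) (x : T) : R :=
  if 0 <= 2 * eta x - 1 then 1 else -1.

Definition margin_assumption (eta : T -> R) (c0 kappa : R) : Prop :=
  forall f : T -> R, prediction_rule f ->
    ('E_P[(fun w => `|f (X w) - bayes_rule eta (X w)|)%R] <=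
     (c0 * (misclassification_error f -
            misclassification_error (bayes_rule eta)) `^ kappa^-1)%:E)%E.

(* Extended-real valued: it is +oo when f(X) has an infinite hinge loss. For a
   function f depending on the sample, it is evaluated at each realization of f,
   so that the expectation only bears on (X, Y). *)
Definition hinge_risk (f : T -> R) : \bar R :=
  ('E_P[(fun w => Num.max 0 (1 - Y w * f (X w)))%R])%E.

Definition optimal_hinge_risk : \bar R :=
  ereal_inf [set hinge_risk f | f in [set f | measurable_fun setT f]].

Definition excess_hinge_risk (f : T -> R) : \bar R :=
  (hinge_risk f - optimal_hinge_risk)%E.

End risks.

Definition mutually_independent {d1 : measure_display} {S : measurableType d1}
    {n : nat} (Z : 'I_n -> Omega -> S) : Prop :=
  forall B : 'I_n -> set S, (forall i, measurable (B i)) ->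
    P (\bigcap_(i in [set: 'I_n]) (Z i @^-1` B i)) =
    (\prod_(i < n) P (Z i @^-1` B i))%E.

Definition identically_distributed {d1 : measure_display} {S : measurableType d1}
    (Z Z' : Omega -> S) : Prop :=
  forall B : set S, measurable B -> P (Z @^-1` B) = P (Z' @^-1` B).

Definition iid_sample {n : nat} (X : Omega -> T) (Y : Omega -> R)
    (Xs : 'I_n -> Omega -> T) (Ys : 'I_n -> Omega -> R) : Prop :=
  mutually_independent (fun i w => (Xs i w, Ys i w)) /\
  forall i, identically_distributed
    (fun w => (Xs i w, Ys i w)) (fun w => (X w, Y w)).

End classification.

Section aggregation.
Context {T : Type} {R : realType}.

Definition convex_hull {M : nat} (f : 'I_M -> T -> R) : set (T -> R) :=
  [set g | exists lambda : 'I_M -> R,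
    [/\ forall j, 0 <= lambda j,
        \sum_(j < M) lambda j = 1 &
        g = (fun x => \sum_(j < M) lambda j * f j x)]].

Definition empirical_hinge_risk {n : nat} (xs : 'I_n -> T) (ys : 'I_n -> R)
    (f : T -> R) : R :=
  n%:R^-1 * \sum_(i < n) Num.max 0 (1 - ys i * f (xs i)).

Definition exp_weight {n M : nat} (xs : 'I_n -> T) (ys : 'I_n -> R)
    (f : 'I_M -> T -> R) (j : 'I_M) : R :=
  expR (\sum_(i < n) ys i * f j (xs i)) /
  \sum_(k < M) expR (\sum_(i < n) ys i * f k (xs i)).

Definition exp_weights_aggregate {n M : nat} (xs : 'I_n -> T) (ys : 'I_n -> R)
    (f : 'I_M -> T -> R) (x : T) : R :=
  \sum_(j < M) exp_weight xs ys f j * f j x.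

End aggregation.

(* Main.v *)
Require Import Defs.
From HB Require Import structures.
From mathcomp Require Import all_boot all_order all_algebra.
From mathcomp Require Import all_classical all_reals all_analysis.
From mathcomp Require Import ring lra.

Import Order.TTheory GRing.Theory Num.Theory.

Local Open Scope classical_set_scope.
Local Open Scope ring_scope.

(** For a rule with values in {-1, 1} the hinge loss is twice the 0-1 loss, and
    on the convex hull of such rules it is affine. Hence the minimum over the
    hull is attained at one of the f_j, the hinge risk of the aggregate is
    2 sum_j w_j R(f_j), and everything reduces to the misclassification risks.
    The optimal hinge risk A* is at most 2 R(f* ), as f* competes in the
    infimum, and the difference has coefficient 1 on the left of the inequality
    but 1 + a on the right.

    Let D_j be the 0-1 loss of f_j minus that of f*, let delta_j be its mean,
    nonnegative by optimality of the Bayes rule ([bayes_rule_optimal]), and put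
    l = log M / n and rho = l^(kappa / (2 kappa - 1)). Write, for each sample,

      sum_j w_j delta_j = (1 + a) sum_j w_j (empirical mean of D_j)
                          + sum_j w_j (delta_j - (1 + a) empirical mean of D_j).

    The first sum is at most the empirical mean of D_k plus l, for every k: this
    is what exponential weights achieve ([softmax_gibbs]). The second is bounded
    by a log-sum-exp at an inverse temperature s ([convex_comb_le_expR]), so
    only the exponential moments at s matter. By independence and a
    Bernstein-type bound ([mgf_le]) they are controlled by the second moment of D_j, which the margin
    assumption bounds by a multiple of delta_j^(1/kappa). Taking s of order
    n l / rho makes the variance term at most a (delta_j + rho), by a Young-type
    inequality ([powR_young]); this is absorbed by the drift - a delta_j due to
    the factor 1 + a ([sample_deviation_le]). What remains is of order
    log M / s, that is rho. When l > 1 the bound is trivial, delta_j being at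
    most 1. All of this is [finite_oracle_inequality].

    The measure theory is kept finite: the losses and the weights depend on
    the observations only through the table of which rules err at which
    observation. This table takes finitely many values, so all the expectations
    are finite sums ([integral_finite_range]), and independence says that the
    law of the table is a product ([sample_pattern_law]). *)

(** * Elementary inequalities *)

(** Follows from exp(x) <= 1 / (1 - x); the constant 2, instead of the optimal
    one, spares any use of the power series. *)
Lemma expR_le_quadratic (R : realType) (x : R) :
  x <= 2^-1 -> expR x <= 1 + x + 2 * x ^+ 2.
Proof.
move=> x_le.
have x_lt1 : 0 < 1 - x by lra.
have inv_le : expR x <= (1 - x)^-1.
  rewrite -[expR x]invrK -expRN lef_pV2 ?posrE ?expR_gt0//.
  exact: expR_ge1Dx.
apply: (le_trans inv_le).
rewrite -[leLHS]mul1r ler_pdivrMr//.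
have -> : (1 + x + 2 * x ^+ 2) * (1 - x) = 1 + x ^+ 2 * (1 - 2 * x) by ring.
by rewrite lerDl mulr_ge0 ?sqr_ge0//; lra.
Qed.

(** The rate of convergence, for l = log M / n. It solves the balance equation
    l * rho^(1/kappa) = rho^2, the property that [powR_young] rests on. *)
Definition rate {R : realType} (l kappa : R) : R :=
  l `^ (kappa / (2 * kappa - 1)).

(** The two terms on the right correspond to the cases delta >= rho and
    delta <= rho, which meet at delta = rho by the balance equation. Unlike
    Young's inequality with conjugate exponents, it has constants that do not
    depend on kappa, and covers kappa = 1. *)
Lemma powR_young (R : realType) (l delta kappa : R) :
  0 < l -> 0 <= delta -> 1 <= kappa ->
  l / rate l kappa * delta `^ kappa^-1 <= delta + rate l kappa.
Proof.
move=> l_gt0 delta_ge0 kappa_ge1; set rho := rate l kappa.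
have rho_gt0 : 0 < rho by exact: powR_gt0.
have kappaV_ge0 : 0 <= kappa^-1 by rewrite invr_ge0; lra.
have balance : l / rho * rho `^ kappa^-1 = rho.
  rewrite mulrAC; apply: (canLR (mulfK _)); first by rewrite gt_eqF.
  rewrite /rho /rate -powRrM -[X in X * _](powRr1 (ltW l_gt0)).
  rewrite -!powRD ?(gt_eqF l_gt0) ?implybT//; congr (_ `^ _).
  by field; apply/andP; split; apply/eqP; lra.
have [delta_le|rho_lt] := leP delta rho.
  apply: (@le_trans _ _ rho); last by rewrite lerDr.
  rewrite -[leRHS]balance ler_wpM2l ?divr_ge0 ?(ltW l_gt0) ?(ltW rho_gt0)//.
  by apply: ge0_ler_powR; rewrite ?nnegrE// ltW.
apply: (@le_trans _ _ delta); last by rewrite lerDl ltW.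
have -> : delta `^ kappa^-1 = rho `^ kappa^-1 * (delta / rho) `^ kappa^-1.
  rewrite -powRM ?divr_ge0 ?(ltW rho_gt0)//.
  by rewrite mulrC divfK// gt_eqF.
rewrite mulrA balance.
have deltaE : rho * (delta / rho) = delta by rewrite mulrC divfK// gt_eqF.
rewrite -[leRHS]deltaE ler_pM2l//; apply: ler1_powR.
  by rewrite ler_pdivlMr// mul1r ltW.
by rewrite invf_le1; lra.
Qed.

(** * Exponential weights *)

Definition softmax {R : realType} {M : nat} (theta : 'I_M -> R)
    (j : 'I_M) : R :=
  expR (theta j) / \sum_(k < M) expR (theta k).

Lemma sum_expR_gt0 (R : realType) (M : nat) (theta : 'I_M -> R) :
  (0 < M)%N -> 0 < \sum_(k < M) expR (theta k).
Proof.
case: M theta => // M theta _; rewrite big_ord_recl ltr_pwDl ?expR_gt0//.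
by apply: sumr_ge0 => i _; exact: expR_ge0.
Qed.

Lemma softmax_ge0 (R : realType) (M : nat) (theta : 'I_M -> R) j :
  0 <= softmax theta j.
Proof.
by rewrite divr_ge0 ?expR_ge0// sumr_ge0// => k _; exact: expR_ge0.
Qed.

Lemma softmax_sum1 (R : realType) (M : nat) (theta : 'I_M -> R) :
  (0 < M)%N -> \sum_j softmax theta j = 1.
Proof. by move=> M_gt0; rewrite -mulr_suml divff// gt_eqF// sum_expR_gt0. Qed.

(** The weights only see differences: this allows replacing the margins
    Y_i f_j(X_i) by the hinge losses, or by the losses relative to f*. *)
Lemma softmax_shift (R : realType) (M : nat) (c : R)
    (theta theta' : 'I_M -> R) :
  (forall j, theta j = c + theta' j) -> softmax theta =1 softmax theta'.
Proof.
move=> shift j; rewrite /softmax.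
under eq_bigr do rewrite shift expRD.
rewrite shift expRD -mulr_sumr -mulf_div.
by rewrite divff ?mul1r// gt_eqF ?expR_gt0.
Qed.

(** The Gibbs variational principle, without the entropy: applying
    x <= exp(x) - 1 at x = c (S j - S k) - ln M and weighting by w j cancels the
    exponential, since w j exp(c (S j - S k)) = w k <= 1. *)
Lemma softmax_gibbs (R : realType) (M : nat) (c : R) (S : 'I_M -> R)
    (k : 'I_M) :
  0 < c ->
  \sum_j softmax (fun j => - (c * S j)) j * S j <= S k + ln M%:R / c.
Proof.
move=> c_gt0; set w := softmax _.
have M_gt0 : (0 < M)%N by exact: leq_ltn_trans (ltn_ord k).
have MR_gt0 : 0 < M%:R :> R by rewrite ltr0n.
have w_sum1 : \sum_j w j = 1 by exact: softmax_sum1.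
have w_k_le1 : w k <= 1.
  by rewrite -w_sum1 (bigD1 k)//= lerDl sumr_ge0// => j _; exact: softmax_ge0.
have term_le j : w j * (c * (S j - S k) - ln M%:R) <= M%:R^-1 - w j.
  apply: (@le_trans _ _ (w j * (expR (c * (S j - S k) - ln M%:R) - 1))).
    rewrite ler_wpM2l ?softmax_ge0//.
    by have := expR_ge1Dx (c * (S j - S k) - ln M%:R); lra.
  rewrite mulrBr mulr1 lerD2r expRB lnK ?posrE// mulrA.
  rewrite -[leRHS]mul1r ler_pM2r ?invr_gt0//.
  suff -> : w j * expR (c * (S j - S k)) = w k by [].
  rewrite /w /softmax mulrAC -expRD; congr (expR _ / _); ring.
have : \sum_j w j * (c * (S j - S k) - ln M%:R) <= \sum_j (M%:R^-1 - w j).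
  exact: ler_sum.
rewrite sumrB w_sum1 sumr_const card_ord -(mulr_natl M%:R^-1).
rewrite divff ?gt_eqF// subrr.
have -> : \sum_j w j * (c * (S j - S k) - ln M%:R) =
    c * (\sum_j w j * S j) - (c * S k + ln M%:R) * \sum_j w j.
  rewrite !mulr_sumr -sumrB; apply: eq_bigr => j _; ring.
rewrite w_sum1 mulr1 subr_le0 -ler_pdivlMl// => /le_trans; apply.
by rewrite mulrDr mulKf ?gt_eqF// mulrC.
Qed.

(** Linearized log-sum-exp: the tangent line of the logarithm at M replaces
    ln (\sum_j expR (s * x j)), so that taking expectations requires no
    Jensen inequality. *)
Lemma convex_comb_le_expR (R : realType) (M : nat) (w x : 'I_M -> R) (s : R) :
  0 < s -> (forall j, 0 <= w j) -> \sum_j w j = 1 ->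
  \sum_j w j * x j <=
    s^-1 * (ln M%:R - 1 + M%:R^-1 * \sum_j expR (s * x j)).
Proof.
case: M w x => [|M] w x s_gt0 w_ge0 w_sum1.
  by move: w_sum1 => /eqP; rewrite big_ord0 eq_sym oner_eq0.
set B := leRHS.
have x_le j : x j <= B.
  rewrite ler_pdivlMl//.
  have := expR_ge1Dx (s * x j - ln M.+1%:R).
  rewrite expRB lnK ?posrE ?ltr0n// => tangent.
  suff sum_ge : expR (s * x j) / M.+1%:R <= M.+1%:R^-1 * \sum_j expR (s * x j).
    move: (le_trans tangent sum_ge); set total := _^-1 * _; lra.
  rewrite mulrC ler_pM2l ?invr_gt0 ?ltr0n// (bigD1 j)//= lerDl.
  by apply: sumr_ge0 => k _; exact: expR_ge0.
rewrite -[leRHS]mul1r -w_sum1 mulr_suml.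
by apply: ler_sum => j _; rewrite ler_wpM2l.
Qed.

(** * Samples from a finite law *)

Definition sample_law {R : realType} {V : finType} {n : nat} (q : V -> R)
  (v : {ffun 'I_n -> V}) : R := \prod_i q (v i).

Lemma sample_law_ge0 (R : realType) (V : finType) (n : nat) (q : V -> R)
    (v : {ffun 'I_n -> V}) :
  (forall e, 0 <= q e) -> 0 <= sample_law q v.
Proof. by move=> q_ge0; apply: prodr_ge0 => i _. Qed.

Lemma sample_law_prod (R : realType) (V : finType) (n : nat) (q : V -> R)
    (phi : 'I_n -> V -> R) :
  \sum_v sample_law q v * \prod_i phi i (v i) =
  \prod_i \sum_e q e * phi i e.
Proof.
by rewrite bigA_distr_bigA; apply: eq_bigr => v _; rewrite -big_split.
Qed.

Lemma sample_law_sum1 (R : realType) (V : finType) (n : nat) (q : V -> R) :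
  \sum_e q e = 1 -> \sum_(v : {ffun 'I_n -> V}) sample_law q v = 1.
Proof.
by move=> q_sum1; rewrite -(bigA_distr_bigA (fun _ => q)) big1.
Qed.

Lemma sample_law_coord (R : realType) (V : finType) (n : nat) (q phi : V -> R)
    (i0 : 'I_n) :
  \sum_e q e = 1 ->
  \sum_v sample_law q v * phi (v i0) = \sum_e q e * phi e.
Proof.
move=> q_sum1.
transitivity (\sum_(v : {ffun 'I_n -> V}) sample_law q v *
    \prod_i (fun i e => if i == i0 then phi e else 1) i (v i)).
  apply: eq_bigr => v _; rewrite (bigD1 i0)//= eqxx big1 ?mulr1// => i.
  by move=> /negPf ->.
rewrite (sample_law_prod _ _ _ _ (fun i e => if i == i0 then phi e else 1)).
rewrite (bigD1 i0)//= [X in _ * X]big1 ?mulr1 => [|i /negPf ->].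
  by apply: eq_bigr => e _; rewrite eqxx.
by rewrite -[RHS]q_sum1; apply: eq_bigr => e _; rewrite mulr1.
Qed.

(** Bernstein's bound for a variable in [-1, 1]; as mu <= 1/2 the quadratic
    majorant of the exponential applies to both signs of D. *)
Lemma mgf_le (R : realType) (V : finType) (q D : V -> R) (mu : R) :
  (forall e, 0 <= q e) -> \sum_e q e = 1 -> (forall e, `|D e| <= 1) ->
  0 <= mu <= 2^-1 ->
  \sum_e q e * expR (- (mu * D e)) <=
    expR (- (mu * \sum_e q e * D e) + 2 * mu ^+ 2 * \sum_e q e * D e ^+ 2).
Proof.
move=> q_ge0 q_sum1 D_le1 /andP[mu_ge0 mu_le].
apply: (@le_trans _ _ (\sum_e q e * (1 - mu * D e + 2 * (mu * D e) ^+ 2))).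
  apply: ler_sum => e _; rewrite ler_wpM2l// -(sqrrN (mu * D e)).
  apply: expR_le_quadratic.
  rewrite -mulrN (le_trans _ mu_le)// -[leRHS]mulr1 ler_wpM2l//.
  by rewrite (le_trans _ (D_le1 e))// -normrN ler_norm.
have -> : \sum_e q e * (1 - mu * D e + 2 * (mu * D e) ^+ 2) =
    1 + (- (mu * \sum_e q e * D e) + 2 * mu ^+ 2 * \sum_e q e * D e ^+ 2).
  rewrite -[X in _ = X + _]q_sum1 !mulr_sumr -sumrN -!big_split/=.
  apply: eq_bigr => e _; ring.
exact: expR_ge1Dx.
Qed.

(** Each observation carries the exponent mu = s (1 + a) / n = b l / rho, and by
    independence the moment is an n-th power. The drift is
    s (delta - (1 + a) delta) = - s a delta; by the choice of b the variance
    term, at most s (1 + a) mu c0 delta^(1/kappa), is at most s a (delta + rho). *)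
Lemma sample_deviation_le (R : realType) (V : finType) (n : nat) (q D : V -> R)
    (a c0 kappa b l s : R) :
  (0 < n)%N -> (forall e, 0 <= q e) -> \sum_e q e = 1 ->
  (forall e, `|D e| <= 1) ->
  0 < a -> 0 < c0 -> 1 <= kappa -> 0 < b -> b <= 2^-1 ->
  (1 + a) * c0 * b <= a -> 0 < l -> l <= 1 ->
  let delta := \sum_e q e * D e in
  0 <= delta ->
  2 * \sum_e q e * D e ^+ 2 <= c0 * delta `^ kappa^-1 ->
  s * (1 + a) = n%:R * (b * (l / rate l kappa)) ->
  \sum_(v : {ffun 'I_n -> V}) sample_law q v *
    expR (s * (delta - (1 + a) / n%:R * (\sum_i D (v i)) - a * rate l kappa))
  <= 1.
Proof.
move=> n_gt0 q_ge0 q_sum1 D_le1 a_gt0 c0_gt0 kappa_ge1 b_gt0 b_le b_small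
  l_gt0 l_le1 delta delta_ge0 margin; set rho := rate l kappa.
have rho_gt0 : 0 < rho by exact: powR_gt0.
have l_le_rho : l <= rho.
  apply: ger1_powR; first by rewrite l_gt0.
  by rewrite ler_pdivrMr; lra.
have nR_gt0 : 0 < n%:R :> R by rewrite ltr0n.
set mu := b * (l / rho) => sE.
have mu_ge0 : 0 <= mu by rewrite !mulr_ge0 ?invr_ge0 ?ltW.
have mu_le : mu <= 2^-1.
  apply: (le_trans _ b_le); rewrite -[leRHS]mulr1 ler_wpM2l ?(ltW b_gt0)//.
  by rewrite ler_pdivrMr// mul1r.
have a1_gt0 : 0 < 1 + a by lra.
have s_ge0 : 0 <= s.
  by rewrite -(pmulr_lge0 _ a1_gt0) sE mulr_ge0// ler0n.
have -> : \sum_(v : {ffun 'I_n -> V}) sample_law q v *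
    expR (s * (delta - (1 + a) / n%:R * (\sum_i D (v i)) - a * rho)) =
    expR (s * (delta - a * rho)) * (\sum_e q e * expR (- (mu * D e))) ^+ n.
  rewrite -[in RHS](card_ord n) -prodr_const.
  rewrite -(sample_law_prod _ _ _ _ (fun _ e => expR (- (mu * D e)))) mulr_sumr.
  apply: eq_bigr => v _; rewrite mulrCA; congr (_ * _).
  rewrite -expR_sum -expRD sumrN -mulr_sumr; congr expR.
  have -> : mu = s * ((1 + a) / n%:R) by rewrite mulrA sE mulrC mulKf// gt_eqF.
  ring.
set sigma := \sum_e q e * D e ^+ 2 in margin *.
apply: (@le_trans _ _ (expR (s * (delta - a * rho)) *
    expR (- (mu * delta) + 2 * mu ^+ 2 * sigma) ^+ n)).
  rewrite ler_wpM2l ?expR_ge0// lerXn2r ?nnegrE ?expR_ge0//.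
    by apply: sumr_ge0 => e _; rewrite mulr_ge0 ?expR_ge0.
  by apply: mgf_le => //; rewrite mu_ge0.
rewrite -expRM_natl -expRD expR_le1.
have -> : s * (delta - a * rho) +
    n%:R * (- (mu * delta) + 2 * mu ^+ 2 * sigma) =
    s * ((1 + a) * (mu * (2 * sigma)) - a * (delta + rho)).
  transitivity (s * (delta - a * rho) +
    (n%:R * mu) * (- delta + 2 * mu * sigma)); first by ring.
  rewrite -sE; ring.
rewrite mulr_ge0_le0// subr_le0.
have young := powR_young _ _ _ _ l_gt0 delta_ge0 kappa_ge1.
apply: (@le_trans _ _ ((1 + a) * (mu * (c0 * delta `^ kappa^-1)))).
  by rewrite ler_wpM2l ?ler_wpM2l//; lra.
have -> : (1 + a) * (mu * (c0 * delta `^ kappa^-1)) =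
  ((1 + a) * c0 * b) * (l / rho * delta `^ kappa^-1) by rewrite /mu; ring.
apply: (@le_trans _ _ (a * (l / rho * delta `^ kappa^-1))).
  by rewrite ler_wpM2r// mulr_ge0 ?powR_ge0// divr_ge0// ltW.
by rewrite ler_wpM2l// ltW.
Qed.

(** * The oracle inequality on a finite space *)

(** The oracle inequality for observations in a finite set V with law q, where
    D j is the excess loss of the j-th rule. The constant is
    1 + 2 a + (1 + a) / b: a term (1 + a) l from the Gibbs bound, a rho from the
    deviations, and ln M / s = (1 + a) rho / b from the log-sum-exp. *)
Lemma finite_oracle_inequality (R : realType) (a c0 : R) :
  0 < a -> 0 < c0 -> exists2 K : R, 1 <= K &
  forall (V : finType) (n M : nat) (q : V -> R) (D : 'I_M -> V -> R)
    (kappa : R) (k : 'I_M),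
  (0 < n)%N -> (1 < M)%N -> 1 <= kappa ->
  (forall e, 0 <= q e) -> \sum_e q e = 1 -> (forall j e, `|D j e| <= 1) ->
  let delta := fun j => \sum_e q e * D j e in
  (forall j, 0 <= delta j) ->
  (forall j, 2 * \sum_e q e * D j e ^+ 2 <= c0 * delta j `^ kappa^-1) ->
  \sum_(v : {ffun 'I_n -> V}) sample_law q v *
    \sum_j softmax (fun j => - (2 * \sum_i D j (v i))) j * delta j
  <= (1 + a) * delta k +
     K * rate (ln M%:R / n%:R) kappa.
Proof.
move=> a_gt0 c0_gt0.
(* 1/2 is the range of validity of the Bernstein bound; the other term lets
   the variance be absorbed by a * delta. *)
pose b := Num.min 2^-1 (a / ((1 + a) * c0)).
have a1_gt0 : 0 < 1 + a by lra.
have b_gt0 : 0 < b by rewrite lt_min invr_gt0 ltr0n/= divr_gt0// mulr_gt0.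
have b_le : b <= 2^-1 by rewrite ge_min lexx.
have b_small : (1 + a) * c0 * b <= a.
  by rewrite mulrC -ler_pdivlMr ?mulr_gt0// ge_min lexx orbT.
have ab_ge0 : 0 <= (1 + a) / b by rewrite divr_ge0 ?ltW.
exists (1 + 2 * a + (1 + a) / b); first by lra.
move=> V n M q D kappa k n_gt0 M_gt1 kappa_ge1 q_ge0 q_sum1 D_le1 delta
  delta_ge0 margin.
set l := ln M%:R / n%:R; set rho := rate l kappa.
have nR_gt0 : 0 < n%:R :> R by rewrite ltr0n.
have MR_gt0 : 0 < M%:R :> R by rewrite ltr0n; exact: ltnW.
have lnM_gt0 : 0 < ln M%:R :> R by rewrite ln_gt0// ltr1n.
have l_gt0 : 0 < l by exact: divr_gt0.
have rho_gt0 : 0 < rho by exact: powR_gt0.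
have law_ge0 (v : {ffun 'I_n -> V}) : 0 <= sample_law q v.
  exact: sample_law_ge0.
have law_sum1 := sample_law_sum1 _ _ n _ q_sum1.
pose w (v : {ffun 'I_n -> V}) := softmax (fun j => - (2 * \sum_i D j (v i))).
have w_ge0 v j : 0 <= w v j by exact: softmax_ge0.
have w_sum1 v : \sum_j w v j = 1 by apply: softmax_sum1; exact: ltnW.
have delta_le1 j : delta j <= 1.
  rewrite -[leRHS]q_sum1; apply: ler_sum => e _.
  rewrite -[leRHS]mulr1 ler_wpM2l//.
  exact: le_trans (ler_norm _) (D_le1 j e).
(* For l > 1 the inverse temperature could leave the range of the Bernstein
   bound, but then rho >= 1 >= delta j. *)
have [l_le1|l_gt1] := leP l 1; last first.
  apply: (@le_trans _ _ 1).
    rewrite -[leRHS]law_sum1; apply: ler_sum => v _.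
    rewrite -[leRHS]mulr1 ler_wpM2l// -[leRHS](w_sum1 v).
    by apply: ler_sum => j _; rewrite -[leRHS]mulr1 ler_wpM2l//; exact: w_ge0.
  have rho_ge1 : 1 <= rho.
    rewrite -(powRr0 l); apply: ler_powR; first exact: ltW.
    by rewrite divr_ge0; lra.
  have : 0 <= (1 + a) * delta k by rewrite mulr_ge0// ltW.
  have : 1 <= (1 + 2 * a + (1 + a) / b) * rho by rewrite mulr_ege1//; lra.
  lra.
have l_le_rho : l <= rho.
  apply: ger1_powR; first by rewrite l_gt0.
  by rewrite ler_pdivrMr; lra.
pose s := n%:R * (b * (l / rho)) / (1 + a).
have s_gt0 : 0 < s by rewrite !mulr_gt0 ?invr_gt0.
pose x (v : {ffun 'I_n -> V}) j :=
  delta j - (1 + a) / n%:R * (\sum_i D j (v i)) - a * rho.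
have pointwise v : \sum_j w v j * delta j <=
    (1 + a) / n%:R * ((\sum_i D k (v i)) + ln M%:R) + a * rho +
    s^-1 * (ln M%:R - 1 + M%:R^-1 * \sum_j expR (s * x v j)).
  have gibbs := softmax_gibbs _ _ _ (fun j => \sum_i D j (v i)) k (ltr0Sn R 1).
  have max_le := convex_comb_le_expR _ _ _ (x v) _ s_gt0 (w_ge0 v) (w_sum1 v).
  have -> : \sum_j w v j * delta j =
      (1 + a) / n%:R * (\sum_j w v j * \sum_i D j (v i)) + a * rho +
      \sum_j w v j * x v j.
    rewrite -[X in _ = _ + X + _]mulr1 -[X in _ = _ + _ * X + _](w_sum1 v).
    rewrite !mulr_sumr -!big_split/=.
    by apply: eq_bigr => j _; rewrite /x; ring.
  apply: lerD => //; rewrite lerD2r ler_wpM2l//.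
    by rewrite divr_ge0// ltW.
  apply: (le_trans gibbs); rewrite lerD2l ler_pdivrMr//; lra.
apply: (@le_trans _ _ (\sum_(v : {ffun 'I_n -> V}) sample_law q v *
    ((1 + a) / n%:R * ((\sum_i D k (v i)) + ln M%:R) + a * rho +
    s^-1 * (ln M%:R - 1 + M%:R^-1 * \sum_j expR (s * x v j))))).
  by apply: ler_sum => v _; rewrite ler_wpM2l//; exact: pointwise.
have mean_k : \sum_(v : {ffun 'I_n -> V}) sample_law q v * (\sum_i D k (v i)) =
    n%:R * delta k.
  under eq_bigr do rewrite mulr_sumr.
  rewrite exchange_big/= (eq_bigr (fun _ => delta k)); last first.
    by move=> i _; exact: (sample_law_coord _ _ _ _ (D k)).
  by rewrite sumr_const card_ord mulr_natl.
pose W := \sum_(v : {ffun 'I_n -> V}) sample_law q v *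
  (M%:R^-1 * \sum_j expR (s * x v j)).
have W_le1 : W <= 1.
  have -> : W = M%:R^-1 * \sum_j \sum_(v : {ffun 'I_n -> V})
      sample_law q v * expR (s * x v j).
    rewrite exchange_big/= mulr_sumr; apply: eq_bigr => v _.
    by rewrite mulrCA mulr_sumr.
  rewrite ler_pdivrMl// mulr1 -[X in _ <= X%:R](card_ord M) -sumr_const.
  apply: ler_sum => j _.
  apply: (sample_deviation_le _ _ _ _ (D j) a c0 kappa b l s) => //.
  - exact: delta_ge0.
  - by rewrite divfK// gt_eqF.
have -> : \sum_(v : {ffun 'I_n -> V}) sample_law q v *
    ((1 + a) / n%:R * ((\sum_i D k (v i)) + ln M%:R) + a * rho +
    s^-1 * (ln M%:R - 1 + M%:R^-1 * \sum_j expR (s * x v j))) =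
    (1 + a) / n%:R * (n%:R * delta k) +
    ((1 + a) / n%:R * ln M%:R + a * rho + s^-1 * (ln M%:R - 1)) + s^-1 * W.
  rewrite -mean_k -[X in _ = _ + X + _]mulr1.
  rewrite -[X in _ = _ + _ * X + _]law_sum1 !mulr_sumr.
  rewrite -!big_split/=; apply: eq_bigr => v _; ring.
have n_neq0 : n%:R != 0 :> R by rewrite gt_eqF.
have lnME : ln M%:R = n%:R * l by rewrite mulrC divfK.
have sVlnM : s^-1 * ln M%:R = (1 + a) / b * rho.
  rewrite /s lnME; field.
  by rewrite !gt_eqF.
have sW : s^-1 * W <= s^-1 by rewrite -[leRHS]mulr1 ler_wpM2l// invr_ge0 ltW.
have al : (1 + a) * l <= (1 + a) * rho by rewrite ler_wpM2l// ltW.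
have -> : (1 + a) / n%:R * ln M%:R = (1 + a) * l by rewrite /l; ring.
have -> : (1 + a) / n%:R * (n%:R * delta k) = (1 + a) * delta k.
  by rewrite mulrA divfK.
rewrite mulrBr sVlnM mulr1 -/rho; lra.
Qed.

(** * Error patterns *)

(** Such an integrand is a simple function; as [G] is arbitrary,
    the weights require no measurability argument. *)
Lemma integral_finite_range (d : measure_display) (Omega : measurableType d)
    (R : realType) (P : probability Omega R) (V : finType) (p : Omega -> V)
    (G : V -> R) :
  (forall v, measurable (p @^-1` [set v])) ->
  (\int[P]_w (G (p w))%:E =
   (\sum_v fine (P (p @^-1` [set v])) * G v)%:E)%E.
Proof.
move=> mp.
transitivity (\int[P]_w (\sum_v (G v)%:E * (\1_(p @^-1` [set v]) w)%:E))%E.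
  apply: eq_integral => w _; rewrite (bigD1 (p w))//= big1 ?adde0.
    by rewrite indicE mem_set// mule1.
  move=> v v_neq; rewrite indicE memNset ?mule0// => /= pw.
  by rewrite pw eqxx in v_neq.
rewrite integral_sum//; last first.
  by move=> v; apply: integrableZl => //; exact: integrable_indic.
rewrite -sumEFin; apply: eq_bigr => v _.
rewrite integralZl//; last exact: integrable_indic.
by rewrite integral_indic// setIT muleC EFinM fineK// fin_num_measure.
Qed.

Lemma measurable_disagree (d' : measure_display) (T : measurableType d')
    (R : realType) (f : T -> R) :
  prediction_rule f -> measurable [set z : T * R | z.2 != f z.1].
Proof.
move=> [mf _].
have m2 : measurable_fun setT (fun z : T * R => z.2) by exact: measurable_snd.
have m1 : measurable_fun setT (fun z : T * R => f z.1).
  by apply: measurableT_comp => //; exact: measurable_fst.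
have := measurable_realfun.measurable_fun_eqr m2 m1.
move=> /(_ measurableT [set false] I).
rewrite setTI (_ : _ @^-1` _ = [set z : T * R | z.2 != f z.1])//.
by apply/seteqP; split => z /=; [move=> ->|move/negPf].
Qed.

(** Over labels in {-1, 1}, this finite table determines the losses of all the
    rules and of their convex combinations. *)
Definition error_pattern {T : Type} {R : realType} {I : finType}
    (F : I -> T -> R) (z : T * R) : {ffun I -> bool} :=
  [ffun i => z.2 != F i z.1].

Lemma measurable_error_pattern (d' : measure_display) (T : measurableType d')
    (R : realType) (I : finType) (F : I -> T -> R) (e : {ffun I -> bool}) :
  (forall i, prediction_rule (F i)) ->
  measurable (error_pattern F @^-1` [set e]).
Proof.
move=> rule_F.
have -> : error_pattern F @^-1` [set e] =
    \bigcap_(i in [set: I])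
      (if e i then [set z | z.2 != F i z.1] else ~` [set z | z.2 != F i z.1]).
  apply/seteqP; split => [z /= <- i _|z /= agree].
    by rewrite ffunE; case: ifPn => //= ne; exact/negP.
  apply/ffunP => i; rewrite ffunE; have := agree i Logic.I.
  by case: (e i) => //= /negP/negbTE.
apply: fin_bigcap_measurable => // i _.
by case: (e i); [|apply: measurableC]; exact: measurable_disagree.
Qed.

Section pattern_law.
Context {d d' : measure_display} {Omega : measurableType d}
  {T : measurableType d'} {R : realType} (P : probability Omega R)
  (X : {RV P >-> T}) (Y : {RV P >-> R}) {I : finType} (F : I -> T -> R).

Definition pattern_at (w : Omega) := error_pattern F (X w, Y w).

Definition pattern_law (e : {ffun I -> bool}) : R :=
  fine (P (pattern_at @^-1` [set e])).

Lemma pattern_law_ge0 e : 0 <= pattern_law e.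
Proof. exact: fine_ge0. Qed.

Context (rule_F : forall i, prediction_rule (F i)).

Lemma measurable_pattern_at e : measurable (pattern_at @^-1` [set e]).
Proof.
have mXY : measurable_fun setT (fun w => (X w, Y w)).
  by apply/measurable_fun_pairP; split; exact: measurable_funPT.
have := mXY measurableT _ (measurable_error_pattern _ _ _ _ F e rule_F).
by rewrite setTI.
Qed.

Lemma integral_pattern (G : {ffun I -> bool} -> R) :
  (\int[P]_w (G (pattern_at w))%:E = (\sum_e pattern_law e * G e)%:E)%E.
Proof. by apply: integral_finite_range; exact: measurable_pattern_at. Qed.

Lemma pattern_law_sum1 : \sum_e pattern_law e = 1.
Proof.
have := integral_pattern (fun=> 1).
rewrite integral_cst// mul1e (_ : _ setT = 1%E); last exact: probability_setT.
move=> -[->].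
by apply: eq_bigr => e _; rewrite mulr1.
Qed.

Lemma misclassification_pattern i :
  misclassification_error P X Y (F i) = \sum_e pattern_law e * (e i)%:R.
Proof.
apply: EFin_inj; rewrite -(integral_pattern (fun e => (e i)%:R)).
have mE : measurable [set w | Y w != F i (X w)].
  have mXY : measurable_fun setT (fun w => (X w, Y w)).
    by apply/measurable_fun_pairP; split; exact: measurable_funPT.
  have := mXY measurableT _ (measurable_disagree _ _ _ (F i) (rule_F i)).
  by rewrite setTI.
rewrite /misclassification_error.
rewrite fineK ?fin_num_measure//.
rewrite -[in LHS](setIT [set w | _]) -integral_indic//.
apply: eq_integral => w _; rewrite indicE ffunE; congr (nat_of_bool _)%:R%:E.
by apply/idP/idP; [move/set_mem|move=> ?; exact/mem_set].
Qed.

Context (Y_pm1 : forall w, Y w = -1 \/ Y w = 1).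

(** A convex combination stays in [-1, 1], where the hinge loss 1 - y u is not
    truncated and hence affine in u; at u = -1 or 1 it is twice the error. *)
Lemma hinge_loss_convex_comb (y : R) (x : T) (lambda : I -> R) :
  y = -1 \/ y = 1 -> (forall i, 0 <= lambda i) -> \sum_i lambda i = 1 ->
  Num.max 0 (1 - y * \sum_i lambda i * F i x) =
  2 * \sum_i lambda i * (y != F i x)%:R.
Proof.
move=> y_pm1 lambda_ge0 lambda_sum1.
have -> : 1 - y * \sum_i lambda i * F i x =
    2 * \sum_i lambda i * (y != F i x)%:R.
  rewrite -[X in X - _]lambda_sum1 !mulr_sumr -sumrB.
  apply: eq_bigr => i _; have [_ /(_ x) f_pm1] := rule_F i.
  have one_neq : (1 == -1 :> R) = false by apply/eqP; lra.
  by case: y_pm1 f_pm1 => -> [->|->];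
    rewrite ?eqxx ?[-1 == 1]eq_sym ?one_neq/=; ring.
by rewrite max_r// mulr_ge0// sumr_ge0// => i _; rewrite mulr_ge0.
Qed.

Lemma hinge_risk_convex_comb (lambda : I -> R) :
  (forall i, 0 <= lambda i) -> \sum_i lambda i = 1 ->
  hinge_risk P X Y (fun x => \sum_i lambda i * F i x) =
  (2 * \sum_i lambda i * misclassification_error P X Y (F i))%:E.
Proof.
move=> lambda_ge0 lambda_sum1.
rewrite /hinge_risk unlock.
rewrite (eq_integral (fun w =>
    (2 * \sum_i lambda i * (pattern_at w i)%:R)%:E)); last first.
  move=> w _; rewrite hinge_loss_convex_comb//.
  by under [in RHS]eq_bigr do rewrite ffunE.
rewrite (integral_pattern (fun e => 2 * \sum_i lambda i * (e i)%:R)).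
congr EFin.
under [in RHS]eq_bigr do rewrite misclassification_pattern mulr_sumr.
rewrite exchange_big/= mulr_sumr; apply: eq_bigr => e _.
rewrite mulrCA; congr (_ * _); rewrite mulr_sumr.
by apply: eq_bigr => i _; rewrite mulrCA.
Qed.

End pattern_law.

(** * Optimality of the Bayes rule *)

Lemma bayes_rule_prediction_rule (d' : measure_display) (T : measurableType d')
    (R : realType) (eta : T -> R) :
  measurable_fun setT eta -> prediction_rule (bayes_rule eta).
Proof.
move=> m_eta; split; last first.
  by move=> x; rewrite /bayes_rule; case: ifP; [right|left].
apply: measurable_fun_ifT => //.
apply: measurable_realfun.measurable_fun_ler => //.
apply: measurable_realfun.measurable_funB => //.
exact: measurable_realfun.measurable_funM.
Qed.

Section bayes.
Context {d d' : measure_display} {Omega : measurableType d}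
  {T : measurableType d'} {R : realType} (P : probability Omega R)
  (X : {RV P >-> T}) (Y : {RV P >-> R}) (eta : T -> R)
  (Y_pm1 : forall w, Y w = -1 \/ Y w = 1)
  (eta_regression : regression_function P X Y eta).

Lemma integrable_regret :
  P.-integrable setT (EFin \o (fun w => 1 - 2 * eta (X w))).
Proof.
have [_ int_eta _] := eta_regression.
rewrite (_ : _ \o _ =
    (cst 1%:E \- (fun w => 2%:E * (eta (X w))%:E))%E); last first.
  by apply/funext.
apply: integrableB => //; last exact: integrableZl.
exact: finite_measure_integrable_cst.
Qed.

(** The errors form the symmetric difference of {Y = 1} and {f(X) = 1}; the
    defining property of the regression function computes their intersection. *)
Lemma misclassification_regression (f : T -> R) : prediction_rule f ->
  misclassification_error P X Y f =
  fine (P (Y @^-1` [set 1])) +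
  \int[P]_(w in X @^-1` (f @^-1` [set 1])) (1 - 2 * eta (X w)).
Proof.
move=> [mf f_pm1]; have [m_eta int_eta etaP] := eta_regression.
have mB' : measurable (f @^-1` [set 1]).
  by rewrite -[X in measurable X]setTI; exact: mf.
set A := Y @^-1` [set 1]; set B := X @^-1` _.
have mA : measurable A by exact: measurable_funPTI.
have mB : measurable B by exact: measurable_funPTI.
have PAB := etaP _ mB'; rewrite -/A -/B in PAB.
have intB : P.-integrable B (EFin \o (eta \o X)).
  by apply: integrableS int_eta.
have one_neq : (1 == -1 :> R) = false by apply/eqP; lra.
have errE : [set w | Y w != f (X w)] = (A `\` B) `|` (B `\` A).
  apply/seteqP; split => w /=; rewrite /A /B/=.
    by case: (Y_pm1 w) (f_pm1 (X w)) => -> [->|->]; rewrite ?eqxx// => _;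
      [right|left]; split=> //; apply/eqP; rewrite eq_sym one_neq.
  by case=> -[] E1 E2; apply/eqP => E3; apply: E2; rewrite -E1 E3.
have P_fin (C : set Omega) : measurable C -> (P C < +oo)%E.
  by move=> mC; rewrite ltey_eq fin_num_measure.
have PAdB : P (A `\` B) = (P A - P (A `&` B))%E.
  by apply: measureD => //; exact: P_fin.
have PBdA : P (B `\` A) = (P B - P (A `&` B))%E.
  by rewrite setIC; apply: measureD => //; exact: P_fin.
have PU : P ((A `\` B) `|` (B `\` A)) = (P (A `\` B) + P (B `\` A))%E.
  apply: measureU; [exact: measurableD|exact: measurableD|].
  by apply/seteqP; split => w //= -[[Aw _] [_ nAw]]; exact: nAw.
rewrite /misclassification_error errE PU PAdB PBdA PAB.
have -> : (\int[P]_(w in B) (eta (X w))%:E = (\int[P]_(w in B) eta (X w))%:E)%E.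
  by rewrite /Rintegral fineK//; exact: integrable_fin_num.
rewrite RintegralB//; last 2 first.
- exact: finite_measure_integrable_cst.
- by have := integrableZl mB 2 intB; apply: eq_integrable.
rewrite RintegralZl// Rintegral_cst//.
have PA_fin : P A \is a fin_num by exact: fin_num_measure.
have PB_fin : P B \is a fin_num by exact: fin_num_measure.
by rewrite -[P A]fineK// -[P B]fineK//=; ring.
Qed.

(** The Bayes rule selects exactly the points where 1 - 2 eta is not positive,
    so {f* = 1} minimizes the integral in [misclassification_regression]. *)
Lemma bayes_rule_optimal (f : T -> R) : prediction_rule f ->
  misclassification_error P X Y (bayes_rule eta) <=
  misclassification_error P X Y f.
Proof.
move=> rule_f; have [m_eta _ _] := eta_regression.
have rule_bayes := bayes_rule_prediction_rule _ _ _ _ m_eta.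
have mpre (g : T -> R) : prediction_rule g ->
    measurable (X @^-1` (g @^-1` [set 1])).
  move=> [mg _]; apply: measurable_funPTI.
  by rewrite -[X in measurable X]setTI; exact: mg.
rewrite !misclassification_regression// lerD2l.
rewrite Rintegral_mkcond [leRHS]Rintegral_mkcond.
have int_patch (g : T -> R) : prediction_rule g -> P.-integrable setT
    (EFin \o (fun w => 1 - 2 * eta (X w)) \_ (X @^-1` (g @^-1` [set 1]))).
  move=> rule_g; rewrite -restrict_EFin -integrable_mkcond; last exact: mpre.
  by apply: integrableS integrable_regret => //; exact: mpre.
apply: le_Rintegral => //; [exact: int_patch|exact: int_patch|].
move=> w _; rewrite /patch.
have in_bayes : (w \in X @^-1` (bayes_rule eta @^-1` [set 1])) =
    (0 <= 2 * eta (X w) - 1).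
  apply/idP/idP => [/set_mem/=|pos]; last first.
    by apply/mem_set; rewrite /= /bayes_rule pos.
  by rewrite /bayes_rule; case: ifP => // _ /eqP; rewrite eq_sym; move/eqP; lra.
rewrite in_bayes; change (@point _) with (0 : R).
by case: (leP 0 (2 * eta (X w) - 1)) => ?; case: ifP => _; lra.
Qed.

End bayes.

(** * Losses and weights for labels in {-1, 1} *)

Lemma hinge_loss_pm1 (R : realType) (y u : R) :
  y = -1 \/ y = 1 -> u = -1 \/ u = 1 -> Num.max 0 (1 - y * u) = 1 - y * u.
Proof. by move=> [] -> [] ->; rewrite max_r//; lra. Qed.

Lemma margin_pm1 (R : realType) (y u : R) :
  y = -1 \/ y = 1 -> u = -1 \/ u = 1 -> y * u = 1 - 2 * (y != u)%:R.
Proof.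
have one_neq : (1 == -1 :> R) = false by apply/eqP; lra.
by move=> [] -> [] ->; rewrite ?eqxx ?[-1 == 1]eq_sym ?one_neq/=; ring.
Qed.

Lemma distance_pm1 (R : realType) (y u u' : R) :
  y = -1 \/ y = 1 -> u = -1 \/ u = 1 -> u' = -1 \/ u' = 1 ->
  `|u - u'| = 2 * ((y != u)%:R - (y != u')%:R) ^+ 2.
Proof.
have one_neq : (1 == -1 :> R) = false by apply/eqP; lra.
have norm2 : `|1 - -1| = 2 :> R by rewrite ger0_norm; lra.
by move=> [] -> [] -> [] ->;
  rewrite ?eqxx ?[-1 == 1]eq_sym ?one_neq/= ?subrr ?normr0 ?[`|-1 - 1|]distrC
    ?norm2; ring.
Qed.

Lemma exp_weightE (T : Type) (R : realType) (n M : nat) (xs : 'I_n -> T)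
    (ys : 'I_n -> R) (f : 'I_M -> T -> R) :
  exp_weight xs ys f = softmax (fun j => \sum_i ys i * f j (xs i)).
Proof. by []. Qed.

Lemma exp_weight_empirical_risk (T : Type) (R : realType) (n M : nat)
    (xs : 'I_n -> T) (ys : 'I_n -> R) (f : 'I_M -> T -> R) (j : 'I_M) :
  (0 < n)%N -> (forall i, ys i = -1 \/ ys i = 1) ->
  (forall j x, f j x = -1 \/ f j x = 1) ->
  exp_weight xs ys f j =
  softmax (fun k => - (n%:R * empirical_hinge_risk xs ys (f k))) j.
Proof.
move=> n_gt0 ys_pm1 f_pm1; rewrite exp_weightE.
apply: (softmax_shift _ _ n%:R) => k.
rewrite /empirical_hinge_risk mulrA divff ?pnatr_eq0 -?lt0n// mul1r.
under [in RHS]eq_bigr do rewrite hinge_loss_pm1//.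
by rewrite sumrB sumr_const card_ord; ring.
Qed.

(** * The law of the sample *)

Section sample.
Context {d d' : measure_display} {Omega : measurableType d}
  {T : measurableType d'} {R : realType} (P : probability Omega R)
  (X : {RV P >-> T}) (Y : {RV P >-> R}) {n : nat}
  (Xs : 'I_n -> {RV P >-> T}) (Ys : 'I_n -> {RV P >-> R})
  (iid_XY : iid_sample P X Y (fun i => Xs i : Omega -> T)
                             (fun i => Ys i : Omega -> R))
  {I : finType} (F : I -> T -> R) (rule_F : forall i, prediction_rule (F i)).

Definition sample_pattern (w : Omega) : {ffun 'I_n -> {ffun I -> bool}} :=
  [ffun i => error_pattern F (Xs i w, Ys i w)].

Let sample_pattern_preimage v : sample_pattern @^-1` [set v] =
  \bigcap_(i in [set: 'I_n])
    ((fun w => (Xs i w, Ys i w)) @^-1` (error_pattern F @^-1` [set v i])).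
Proof.
apply/seteqP; split => [w /= <- i _|w /= agree]; first by rewrite /= ffunE.
by apply/ffunP => i; rewrite ffunE; exact: (agree i Logic.I).
Qed.

Lemma measurable_sample_pattern v : measurable (sample_pattern @^-1` [set v]).
Proof.
rewrite sample_pattern_preimage; apply: fin_bigcap_measurable => // i _.
exact: (measurable_pattern_at P (Xs i) (Ys i) F rule_F).
Qed.

(** Each value of the table of errors is an intersection of events about the
    single observations: mutual independence gives the product, and identical
    distribution makes the factors values of one law. *)
Lemma sample_pattern_law v :
  fine (P (sample_pattern @^-1` [set v])) =
  sample_law (pattern_law P X Y F) v.
Proof.
have [indep ident] := iid_XY.
have mF e := measurable_error_pattern _ _ _ _ F e rule_F.
rewrite sample_pattern_preimage.
rewrite (indep (fun i => error_pattern F @^-1` [set v i]))//.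
rewrite (eq_bigr (fun i => (pattern_law P X Y F (v i))%:E)); last first.
  move=> i _; rewrite (ident i _ (mF _)) fineK// fin_num_measure//.
  exact: measurable_pattern_at.
by rewrite prodEFin.
Qed.

Lemma integral_sample_pattern (G : {ffun 'I_n -> {ffun I -> bool}} -> R) :
  (\int[P]_w (G (sample_pattern w))%:E =
   (\sum_v sample_law (pattern_law P X Y F) v * G v)%:E)%E.
Proof.
rewrite integral_finite_range; last exact: measurable_sample_pattern.
by under eq_bigr do rewrite sample_pattern_law.
Qed.

End sample.

(** * The aggregate with exponential weights *)

Theorem theorem2 (R : realType) (a c0 : R) (a_gt0 : 0 < a) (c0_gt0 : 0 < c0) :
  exists C : R, 0 < C /\
  forall (d d' : measure_display) (Omega : measurableType d)
    (T : measurableType d') (P : probability Omega R)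
    (X : {RV P >-> T}) (Y : {RV P >-> R}) (eta : T -> R)
    (n M : nat) (Xs : 'I_n -> {RV P >-> T}) (Ys : 'I_n -> {RV P >-> R})
    (f : 'I_M -> T -> R) (kappa : R),
  (0 < n)%N -> (3 <= M)%N -> 1 <= kappa ->
  (forall w, Y w = -1 \/ Y w = 1) ->
  (forall i w, Ys i w = -1 \/ Ys i w = 1) ->
  iid_sample P X Y (fun i => Xs i : Omega -> T) (fun i => Ys i : Omega -> R) ->
  (forall j, prediction_rule (f j)) ->
  regression_function P X Y eta ->
  margin_assumption P X Y eta c0 kappa ->
  let xs := fun w i => Xs i w in
  let ys := fun w i => Ys i w in
  (forall w j,
    exp_weight (xs w) (ys w) f j =
    expR (- (n%:R * empirical_hinge_risk (xs w) (ys w) (f j))) /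
    \sum_(k < M) expR (- (n%:R * empirical_hinge_risk (xs w) (ys w) (f k)))) /\
  exists g : T -> R,
    [/\ convex_hull f g,
        forall h, convex_hull f h ->
          (excess_hinge_risk P X Y g <= excess_hinge_risk P X Y h)%E &
        (\int[P]_w excess_hinge_risk P X Y
                     (exp_weights_aggregate (xs w) (ys w) f)
         <= (1 + a)%:E * excess_hinge_risk P X Y g
            + (C * (ln M%:R / n%:R) `^ (kappa / (2 * kappa - 1)))%:E)%E].
Proof.
have [K K_ge1 oracle] := finite_oracle_inequality R a c0 a_gt0 c0_gt0.
exists (2 * K); split; first by lra.
move=> d d' Omega T P X Y eta n M Xs Ys f kappa n_gt0 M_ge3 kappa_ge1 Y_pm1
  Ys_pm1 iid_XY rule_f eta_regression margin xs ys.
have M_gt0 : (0 < M)%N by exact: leq_trans M_ge3.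
split=> [w j|].
  apply: exp_weight_empirical_risk => // [i|k x]; first exact: Ys_pm1.
  by have [_] := rule_f k.
have [m_eta _ _] := eta_regression.
pose fstar := bayes_rule eta.
have rule_fstar : prediction_rule fstar by exact: bayes_rule_prediction_rule.
pose risk h := misclassification_error P X Y h.
have hull_risk (lambda : 'I_M -> R) : (forall j, 0 <= lambda j) ->
    \sum_j lambda j = 1 ->
    hinge_risk P X Y (fun x => \sum_j lambda j * f j x) =
    (2 * \sum_j lambda j * risk (f j))%:E.
  exact: hinge_risk_convex_comb.
have rule_hinge_risk h : prediction_rule h ->
    hinge_risk P X Y h = (2 * risk h)%:E.
  move=> rule_h.
  have := hinge_risk_convex_comb P X Y (fun _ : 'I_1 => h) (fun=> rule_h) Y_pm1
    (fun=> 1) (fun=> ler01).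
  rewrite !big_ord1 mul1r => <- //; congr (hinge_risk _ _ _ _).
  by apply/funext => x; rewrite big_ord1 mul1r.
have [alpha alphaE alpha_le] : exists2 alpha,
    optimal_hinge_risk P X Y = alpha%:E & alpha <= 2 * risk fstar.
  have opt_ge0 : (0 <= optimal_hinge_risk P X Y)%E.
    apply: le_ereal_inf_tmp => _ [h _ <-].
    rewrite /hinge_risk unlock; apply: integral_ge0 => w _.
    by rewrite lee_fin le_max lexx.
  have opt_le : (optimal_hinge_risk P X Y <= (2 * risk fstar)%:E)%E.
    rewrite -rule_hinge_risk//; apply: ereal_inf_lbound.
    by exists fstar => //; case: rule_fstar.
  have opt_fin : optimal_hinge_risk P X Y \is a fin_num.
    by rewrite ge0_fin_numE//; exact: le_lt_trans opt_le (ltry _).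
  exists (fine (optimal_hinge_risk P X Y)); first by rewrite fineK.
  by rewrite -lee_fin fineK.
have hull_excess (lambda : 'I_M -> R) : (forall j, 0 <= lambda j) ->
    \sum_j lambda j = 1 ->
    excess_hinge_risk P X Y (fun x => \sum_j lambda j * f j x) =
    (2 * (\sum_j lambda j * risk (f j)) - alpha)%:E.
  by move=> ? ?; rewrite /excess_hinge_risk alphaE hull_risk.
have rule_excess h : prediction_rule h ->
    excess_hinge_risk P X Y h = (2 * risk h - alpha)%:E.
  by move=> ?; rewrite /excess_hinge_risk alphaE rule_hinge_risk.
pose k0 := Ordinal M_gt0.
pose k := [arg min_(j < k0) risk (f j)]%O.
have k_min j : risk (f k) <= risk (f j).
  by rewrite /k; case: arg_minP => // i _; exact.
exists (f k); split.
- exists (fun j => (j == k)%:R); split=> //.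
  + by rewrite (bigD1 k)//= eqxx big1 ?addr0// => j /negbTE ->.
  + apply/funext => x; rewrite (bigD1 k)//= eqxx mul1r big1 ?addr0//.
    by move=> j /negbTE ->; rewrite mul0r.
- move=> _ [lambda [lambda_ge0 lambda_sum1 ->]].
  rewrite rule_excess// hull_excess// lee_fin lerD2r ler_pM2l//.
  rewrite -[leLHS]mul1r -lambda_sum1 mulr_suml; apply: ler_sum => j _.
  by rewrite ler_wpM2l.
(* The Bayes rule is adjoined to the family, as the index None. *)
pose F (o : option 'I_M) := if o is Some j then f j else fstar.
have rule_F o : prediction_rule (F o) by case: o.
pose q := pattern_law P X Y F.
pose D (j : 'I_M) (e : {ffun option 'I_M -> bool}) : R :=
  (e (Some j))%:R - (e None)%:R.
have deltaE j : \sum_e q e * D j e = risk (f j) - risk fstar.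
  rewrite /risk -[f j]/(F (Some j)) -[fstar]/(F None).
  rewrite !misclassification_pattern// -sumrB.
  by apply: eq_bigr => e _; rewrite mulrBr.
have D_le1 j e : `|D j e| <= 1.
  by rewrite /D; case: (e _); case: (e _); rewrite ?subrr ?subr0 ?sub0r ?normrN
    ?normr0 ?normr1.
have delta_ge0 j : 0 <= \sum_e q e * D j e.
  by rewrite deltaE subr_ge0; exact: bayes_rule_optimal.
have D_margin j : 2 * \sum_e q e * D j e ^+ 2 <=
    c0 * (\sum_e q e * D j e) `^ kappa^-1.
  rewrite -lee_fin deltaE; apply: le_trans (margin _ (rule_f j)).
  rewrite mulr_sumr (eq_bigr (fun e => q e * (2 * D j e ^+ 2))); last first.
    by move=> e _; rewrite mulrCA.
  rewrite -(integral_pattern P X Y F rule_F (fun e => 2 * D j e ^+ 2)) unlock.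
  rewrite le_eqVlt; apply/orP; left; apply/eqP; apply: eq_integral => w _.
  rewrite /D !ffunE/= (distance_pm1 _ (Y w))//.
    by have [_] := rule_f j.
  by have [_] := rule_fstar.
have := oracle _ n M q D kappa k n_gt0 (ltnW M_ge3) kappa_ge1
  (pattern_law_ge0 P X Y F) (pattern_law_sum1 P X Y F rule_F) D_le1 delta_ge0
  D_margin.
set rho := rate _ _.
pose wgt (v : {ffun 'I_n -> {ffun option 'I_M -> bool}}) :=
  softmax (fun j => - (2 * \sum_i D j (v i))).
have weightE w : exp_weight (xs w) (ys w) f =1
    wgt (sample_pattern P Xs Ys F w).
  rewrite exp_weightE.
  apply: (softmax_shift _ _
    (\sum_i (1 - 2 * (Ys i w != fstar (Xs i w))%:R))) => j.
  rewrite mulr_sumr -sumrB; apply: eq_bigr => i _.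
  rewrite (margin_pm1 _ (Ys i w))//; last by have [_] := rule_f j.
  by rewrite /D !ffunE/=; ring.
have wgt_sum1 v : \sum_j wgt v j = 1 by exact: softmax_sum1.
move=> bound.
under eq_integral => w _.
  rewrite hull_excess; [|by move=> j; exact: softmax_ge0|exact: softmax_sum1].
  under eq_bigr do rewrite weightE.
  over.
rewrite (integral_sample_pattern P X Y Xs Ys iid_XY F rule_F
  (fun v => 2 * (\sum_j wgt v j * risk (f j)) - alpha)).
rewrite rule_excess// -EFinM -EFinD lee_fin -/(rate _ _) -/rho.
have -> : \sum_v sample_law q v * (2 * (\sum_j wgt v j * risk (f j)) - alpha) =
    2 * (\sum_v sample_law q v * \sum_j wgt v j * (\sum_e q e * D j e)) +
    (2 * risk fstar - alpha).
  rewrite -[X in _ = _ + X]mulr1.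
  have q_sum1 := pattern_law_sum1 P X Y F rule_F.
  rewrite -[X in _ = _ + _ * X](sample_law_sum1 _ _ n _ q_sum1).
  rewrite !mulr_sumr -big_split/=; apply: eq_bigr => v _.
  under [in RHS]eq_bigr do rewrite deltaE mulrBr.
  rewrite sumrB -mulr_suml wgt_sum1; ring.
move: bound; rewrite deltaE -/(wgt _) => bound.
(* The remainder 2 R(f* ) - A* appears with coefficient 1 on the left and
   1 + a on the right. *)
have : 0 <= a * (2 * risk fstar - alpha) by rewrite mulr_ge0 ?subr_ge0// ltW.
move: bound; set E := \sum_v _; lra.
Qed.
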